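(* Let $0<q<1$, let $r,s\ge 0$ be integers, let $a_1,\dots,a_r\in\mathbb{C}$, let $b_1,\dots,b_s$ be real numbers with $0\le b_1,\dots,b_s<1$, and let $l>0$ be real. Define the entire function $$f(z)=\sum_{k=0}^{\infty}\frac{(a_1,\dots,a_r;q)_k\,q^{lk^2}}{(b_1,\dots,b_s,q;q)_k}\,z^k .$$ Then for every nonzero complex number $z$, $$|f(z)|\le\frac{(-|a_1|,\dots,-|a_r|;q)_\infty}{(b_1,\dots,b_s,q^{l};q)_\infty}\left\{\sqrt[4]{|z|^2q^{-l}}\;\exp\left(-\frac{\log^2|z|}{4l\log q}\right)\right\}.$$ In particular, if $0\le b_1,\dots,b_s<1$ and $0<s+1-r$, then for every nonzero complex number $z$, $$\left|{}_r\phi_s\left(\begin{array}{c|c}\begin{array}{c}a_1,\dots,a_r\\ b_1,\dots,b_s\end{array}& q,z\end{array}\right)\right|\le\frac{(-|a_1|,\dots,-|a_r|;q)_\infty}{(b_1,\dots,b_s,q^{(s+1-r)/2};q)_\infty}\left\{\sqrt[4]{|z|^2q^{3(r-s-1)/2}}\;\exp\left(\frac{\log^2\left[|z|q^{(r-s-1)/2}\right]}{2(r-s-1)\log q}\right)\right\}.$$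
   Context: For $0<q<1$ and $a\in\mathbb{C}$: $(a;q)_0=1$, $(a;q)_n=\prod_{k=0}^{n-1}(1-aq^k)$ for integers $n\ge1$, and $(a;q)_\infty=\prod_{k=0}^{\infty}(1-aq^k)$. Multishifted factorials: $(a_1,\dots,a_m;q)_n=\prod_{j=1}^m(a_j;q)_n$ for $n$ a nonnegative integer or $n=\infty$ (empty products equal $1$). The notation $\log^2 x$ means $(\log x)^2$. The confluent basic hypergeometric series is, for $s+1-r>0$, $${}_r\phi_s\left(\begin{array}{c|c}\begin{array}{c}a_1,\dots,a_r\\ b_1,\dots,b_s\end{array}& q,z\end{array}\right)=\sum_{k=0}^\infty\frac{(a_1,\dots,a_r;q)_k}{(q,b_1,\dots,b_s;q)_k}\,z^k\left(-q^{(k-1)/2}\right)^{k(s+1-r)}.$$ *)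

(* Defs.v *)
From Stdlib Require Import Reals List.
From Coquelicot Require Import Coquelicot.
Import ListNotations.
Local Open Scope R_scope.

Fixpoint Rqpoch (a q : R) (n : nat) : R :=
  match n with
  | O => 1
  | S m => Rqpoch a q m * (1 - a * q ^ m)
  end.

Fixpoint Cqpoch (a : C) (q : R) (n : nat) : C :=
  match n with
  | O => RtoC 1
  | S m => (Cqpoch a q m * (1 - a * RtoC (q ^ m)))%C
  end.

Lemma Cqpoch_RtoC (a q : R) (n : nat) :
  Cqpoch (RtoC a) q n = RtoC (Rqpoch a q n).
Proof.
induction n as [|n IH]; simpl; [reflexivity|].
now rewrite IH, <- RtoC_mult, <- RtoC_minus, <- RtoC_mult.
Qed.

Definition Rqpoch_inf (a q : R) : R := real (Lim_seq (Rqpoch a q)).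

Definition Cqpochs (l : list C) (q : R) (n : nat) : C :=
  fold_right Cmult (RtoC 1) (map (fun a => Cqpoch a q n) l).

Definition Rqpochs_inf (l : list R) (q : R) : R :=
  fold_right Rmult 1 (map (fun a => Rqpoch_inf a q) l).

(* Convergence of complex series is [is_series] in [C] as a normed module over
   itself; Coquelicot's [Series] is real-valued, hence the split below. *)
Definition is_Cseries (u : nat -> C) (w : C) : Prop :=
  @is_series C_AbsRing C_NormedModule u w.

Definition CSeries (u : nat -> C) : C :=
  (Series (fun k => Re (u k)), Series (fun k => Im (u k))).

Lemma is_Cseries_unique (u : nat -> C) (w : C) :
  is_Cseries u w -> CSeries u = w.
Proof.
intros H.
assert (S1 : forall n, Re (sum_n u n) = sum_n (fun k => Re (u k)) n).
{ induction n as [|n IH]; [now rewrite !sum_O|].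
  rewrite !sum_Sn, <- IH. reflexivity. }
assert (S2 : forall n, Im (sum_n u n) = sum_n (fun k => Im (u k)) n).
{ induction n as [|n IH]; [now rewrite !sum_O|].
  rewrite !sum_Sn, <- IH. reflexivity. }
unfold CSeries. destruct w as [x y]. f_equal; apply is_series_unique.
- apply filterlim_ext with (1 := S1).
  intros P [e He].
  apply (H (fun z => P (Re z))).
  exists e. intros y' Hy. apply He, Hy.
- apply filterlim_ext with (1 := S2).
  intros P [e He].
  apply (H (fun z => P (Im z))).
  exists e. intros y' Hy. apply He, Hy.
Qed.

Definition f_term (a : list C) (b : list R) (q l : R) (z : C) (k : nat) : C :=
  (Cqpochs a q k * RtoC (Rpower q (l * INR k ^ 2))
   / Cqpochs (map RtoC b ++ [RtoC q]) q k * z ^ k)%C.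

Definition f_series (a : list C) (b : list R) (q l : R) (z : C) : C :=
  CSeries (f_term a b q l z).

(* The series [r phi s] for [r < s + 1], with [r = length a], [s = length b]:
   in that range the truncated [s + 1 - r] is the integer one. *)
Definition rphis_term (a b : list C) (q : R) (z : C) (k : nat) : C :=
  (Cqpochs a q k / Cqpochs (RtoC q :: b) q k * z ^ k
   * RtoC ((- Rpower q ((INR k - 1) / 2))
             ^ (k * (length b + 1 - length a))))%C.

Definition rphis (a b : list C) (q : R) (z : C) : C :=
  CSeries (rphis_term a b q z).

(* Main.v *)
Require Import Defs.
From Stdlib Require Import Reals List Lra Lia.
From Coquelicot Require Import Coquelicot.
Import ListNotations.
Local Open Scope R_scope.

(** The estimate is a termwise one. In the numerator
    [|(a;q)_k| <= (-|a|;q)_k <= (-|a|;q)_oo], the last sequence being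
    increasing in [k]; in the denominator [(b;q)_k >= (b;q)_oo > 0], as
    [(b;q)_k] decreases with [k] when [0 <= b < 1]. This leaves the
    series of [q^(l k^2) |z|^k / (q;q)_k], in which one writes
<<
      q^(l k^2) |z|^k = q^(l k (k-1)) |z|^k * (q^l)^k.
>>
    The exponent of the first factor is a concave quadratic in [k], so
    completing the square bounds it, uniformly in [k], by
    [exp (-(log |z| - l log q)^2 / (4 l log q))]; expanding that square gives
    exactly the braces of the theorem ([gauss_term_le]).

    What is left is Euler's series [sum_k x^k / (q;q)_k] at [x = q^l], whose
    partial sums [S_n] are at most [1 / (x;q)_oo]. This follows from the
    functional equation [S_(n+1)(x) - S_(n+1)(qx) = x S_n(x)]: since
    [S_n] increases with [n], it gives [(1 - x) S_n(x) <= S_n(qx)], hence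
    [(x;q)_m S_n(x) <= S_n(x q^m)], and the right-hand side tends to
    [S_n(0) = 1] as [m] grows ([Euler_sum_le]).

    The confluent series is the instance [l = (s+1-r)/2] of [f], evaluated at
    [z] times [(-q^(-1/2))^(s+1-r)] ([rphis_term_f_term]), so the second bound
    follows from the first by rewriting. *)

(** * Shifted factorials and their infinite products *)

Lemma pow_unit_interval (q : R) (n : nat) : 0 < q < 1 -> 0 < q ^ n <= 1.
Proof.
intros Hq; split; [apply pow_lt; lra|].
rewrite <- (pow1 n); apply pow_incr; lra.
Qed.

Lemma Rqpoch_pos (a q : R) (n : nat) :
  0 < q < 1 -> a < 1 -> 0 < Rqpoch a q n.
Proof.
intros Hq Ha; induction n as [|n IH]; simpl; [lra|].
pose proof (pow_unit_interval q n Hq).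
apply Rmult_lt_0_compat; [exact IH|nra].
Qed.

(** Each factor satisfies [1 - a q^k <= exp (-a q^k)]; the exponents add up to
    a geometric sum, so the increasing sequence [(a;q)_n] is bounded. *)
Lemma Rqpoch_upper (a q : R) (n : nat) :
  0 < q < 1 -> a <= 0 ->
  Rqpoch a q n <= exp (- a * ((1 - q ^ n) / (1 - q))).
Proof.
intros Hq Ha; induction n as [|n IH]; simpl.
- replace (- a * ((1 - 1) / (1 - q))) with 0 by (field; lra).
  rewrite exp_0; lra.
- pose proof (pow_unit_interval q n Hq).
  replace (- a * ((1 - q * q ^ n) / (1 - q)))
    with (- a * ((1 - q ^ n) / (1 - q)) + - a * q ^ n) by (field; lra).
  rewrite exp_plus; apply Rmult_le_compat.
  + apply Rlt_le, Rqpoch_pos; lra.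
  + nra.
  + exact IH.
  + pose proof (exp_ineq1_le (- a * q ^ n)); lra.
Qed.

(** With [c = a / (1 - a)], the inequality [1 - a t >= 1 / (1 + c t)] on
    [0 <= t <= 1] gives [1 - a q^k >= exp (-c q^k)]. The resulting bound stays
    away from 0 as [n] grows, which makes the infinite product nonzero. *)
Lemma Rqpoch_lower (a q : R) (n : nat) :
  0 < q < 1 -> 0 <= a < 1 ->
  exp (- (a / (1 - a)) * ((1 - q ^ n) / (1 - q))) <= Rqpoch a q n.
Proof.
intros Hq Ha; induction n as [|n IH]; simpl.
- replace (- (a / (1 - a)) * ((1 - 1) / (1 - q))) with 0 by (field; lra).
  rewrite exp_0; lra.
- pose proof (pow_unit_interval q n Hq) as Hp.
  set (c := a / (1 - a)) in *.
  assert (Hc : c * (1 - a) = a) by (unfold c; field; lra).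
  assert (Hc0 : 0 <= c) by (apply Rdiv_le_0_compat; lra).
  clearbody c.
  replace (- c * ((1 - q * q ^ n) / (1 - q)))
    with (- c * ((1 - q ^ n) / (1 - q)) + - (c * q ^ n)) by (field; lra).
  rewrite exp_plus; apply Rmult_le_compat;
    [apply Rlt_le, exp_pos|apply Rlt_le, exp_pos|exact IH|].
  rewrite exp_Ropp.
  pose proof (exp_ineq1_le (c * q ^ n)) as He.
  assert (0 <= c * q ^ n) by (apply Rmult_le_pos; lra).
  (* [(1 - a t) (1 + c t) >= 1] for [0 <= t <= 1], since [c - a = a c]. *)
  assert (Hk : 1 <= (1 - a * q ^ n) * (1 + c * q ^ n)).
  { replace ((1 - a * q ^ n) * (1 + c * q ^ n))
      with (1 + q ^ n * ((c * (1 - a) - a) + a * c * (1 - q ^ n))) by ring.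
    rewrite Hc.
    assert (0 <= q ^ n * (a * c * (1 - q ^ n)))
      by (repeat apply Rmult_le_pos; lra).
    lra. }
  assert (0 < 1 - a * q ^ n) by nra.
  apply Rmult_le_reg_r with (exp (c * q ^ n)); [apply exp_pos|].
  rewrite Rinv_l by (apply Rgt_not_eq, exp_pos). nra.
Qed.

Lemma Rqpoch_le_inf (a q : R) (n : nat) :
  0 < q < 1 -> a <= 0 -> Rqpoch a q n <= Rqpoch_inf a q.
Proof.
intros Hq Ha.
assert (Hincr : forall k, Rqpoch a q k <= Rqpoch a q (S k)).
{ intros k; simpl.
  pose proof (pow_unit_interval q k Hq).
  assert (0 < Rqpoch a q k) by (apply Rqpoch_pos; lra).
  assert (0 <= Rqpoch a q k * (- a * q ^ k))
    by (repeat apply Rmult_le_pos; lra).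
  lra. }
apply is_lim_seq_incr_compare; [|exact Hincr].
apply Lim_seq_correct', ex_finite_lim_seq_incr with (exp (- a / (1 - q)));
  [exact Hincr|].
intros k; eapply Rle_trans; [apply Rqpoch_upper; lra|].
pose proof (pow_unit_interval q k Hq).
assert (Hle : - a * ((1 - q ^ k) / (1 - q)) <= - a / (1 - q)).
{ unfold Rdiv. assert (0 < / (1 - q)) by (apply Rinv_0_lt_compat; lra).
  assert (0 <= (- a * / (1 - q)) * q ^ k) by (repeat apply Rmult_le_pos; lra).
  lra. }
destruct Hle as [Hlt|Heq]; [apply Rlt_le, exp_increasing, Hlt|rewrite Heq; lra].
Qed.

Lemma Rqpoch_decr (a q : R) (n : nat) :
  0 < q < 1 -> 0 <= a < 1 -> Rqpoch a q (S n) <= Rqpoch a q n.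
Proof.
intros Hq Ha; simpl.
pose proof (pow_unit_interval q n Hq).
assert (0 < Rqpoch a q n) by (apply Rqpoch_pos; lra).
assert (0 <= Rqpoch a q n * (a * q ^ n)) by (repeat apply Rmult_le_pos; lra).
lra.
Qed.

Lemma is_lim_Rqpoch (a q : R) :
  0 < q < 1 -> 0 <= a < 1 -> is_lim_seq (Rqpoch a q) (Rqpoch_inf a q).
Proof.
intros Hq Ha.
apply Lim_seq_correct', ex_finite_lim_seq_decr with 0.
- intros n; apply Rqpoch_decr; lra.
- intros n; apply Rlt_le, Rqpoch_pos; lra.
Qed.

Lemma Rqpoch_inf_le (a q : R) (n : nat) :
  0 < q < 1 -> 0 <= a < 1 -> Rqpoch_inf a q <= Rqpoch a q n.
Proof.
intros Hq Ha; apply is_lim_seq_decr_compare; [now apply is_lim_Rqpoch|].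
intros k; now apply Rqpoch_decr.
Qed.

Lemma Rqpoch_inf_pos (a q : R) :
  0 < q < 1 -> 0 <= a < 1 -> 0 < Rqpoch_inf a q.
Proof.
intros Hq Ha.
apply Rlt_le_trans with (exp (- (a / (1 - a)) * (1 / (1 - q)))); [apply exp_pos|].
apply (is_lim_seq_le (fun _ => exp (- (a / (1 - a)) * (1 / (1 - q))))
  (Rqpoch a q) (Finite _) (Finite _));
  [|apply is_lim_seq_const|now apply is_lim_Rqpoch].
intros n; eapply Rle_trans; [|now apply Rqpoch_lower].
pose proof (pow_unit_interval q n Hq).
assert (Hc : 0 <= a / (1 - a)) by (apply Rdiv_le_0_compat; lra).
revert Hc; generalize (a / (1 - a)); intros c Hc.
assert (Hle : - c * (1 / (1 - q)) <= - c * ((1 - q ^ n) / (1 - q))).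
{ unfold Rdiv. assert (0 < / (1 - q)) by (apply Rinv_0_lt_compat; lra).
  assert (0 <= (c * / (1 - q)) * q ^ n)
    by (repeat apply Rmult_le_pos; lra).
  lra. }
destruct Hle as [Hlt|Heq]; [apply Rlt_le, exp_increasing, Hlt|rewrite Heq; lra].
Qed.

(** * Multishifted factorials *)

Lemma Rqpochs_inf_app (l1 l2 : list R) (q : R) :
  Rqpochs_inf (l1 ++ l2) q = Rqpochs_inf l1 q * Rqpochs_inf l2 q.
Proof.
unfold Rqpochs_inf; induction l1 as [|x l1 IH]; simpl; [ring|].
rewrite IH; ring.
Qed.

Lemma Cqpochs_app (l1 l2 : list C) (q : R) (n : nat) :
  Cqpochs (l1 ++ l2) q n = (Cqpochs l1 q n * Cqpochs l2 q n)%C.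
Proof.
unfold Cqpochs; induction l1 as [|x l1 IH]; simpl; [ring|].
rewrite IH; ring.
Qed.

Lemma Cmod_Cqpoch_le (a : C) (q : R) (n : nat) :
  0 < q < 1 -> Cmod (Cqpoch a q n) <= Rqpoch (- Cmod a) q n.
Proof.
intros Hq; induction n as [|n IH]; simpl; [rewrite Cmod_1; lra|].
rewrite Cmod_mult.
apply Rmult_le_compat; try apply Cmod_ge_0; [exact IH|].
unfold Cminus; eapply Rle_trans; [apply Cmod_triangle|].
rewrite Cmod_1, Cmod_opp, Cmod_mult, Cmod_R, Rabs_pos_eq; [lra|].
apply pow_le; lra.
Qed.

Lemma Cmod_Cqpochs_le (a : list C) (q : R) (n : nat) :
  0 < q < 1 ->
  Cmod (Cqpochs a q n) <= Rqpochs_inf (map (fun x => - Cmod x) a) q.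
Proof.
intros Hq; unfold Cqpochs, Rqpochs_inf.
induction a as [|x a IH]; simpl; [rewrite Cmod_1; lra|].
rewrite Cmod_mult.
apply Rmult_le_compat; try apply Cmod_ge_0; [|exact IH].
eapply Rle_trans; [now apply Cmod_Cqpoch_le|].
apply Rqpoch_le_inf; [exact Hq|]. pose proof (Cmod_ge_0 x); lra.
Qed.

Lemma Rqpochs_inf_pos (b : list R) (q : R) :
  0 < q < 1 -> (forall x, In x b -> 0 <= x < 1) -> 0 < Rqpochs_inf b q.
Proof.
intros Hq; unfold Rqpochs_inf.
induction b as [|x b IH]; simpl; intros Hb; [lra|].
apply Rmult_lt_0_compat; [apply Rqpoch_inf_pos|apply IH]; auto.
Qed.

Lemma Rqpochs_inf_le_Cmod (b : list R) (q : R) (n : nat) :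
  0 < q < 1 -> (forall x, In x b -> 0 <= x < 1) ->
  Rqpochs_inf b q <= Cmod (Cqpochs (map RtoC b) q n).
Proof.
intros Hq; unfold Cqpochs, Rqpochs_inf.
induction b as [|x b IH]; simpl; intros Hb; [rewrite Cmod_1; lra|].
assert (Hx : 0 <= x < 1) by auto.
rewrite Cmod_mult, Cqpoch_RtoC, Cmod_R.
pose proof (Rqpoch_pos x q n Hq (proj2 Hx)).
rewrite Rabs_pos_eq by lra.
apply Rmult_le_compat.
- now apply Rlt_le, Rqpoch_inf_pos.
- apply Rlt_le, (Rqpochs_inf_pos b q); auto.
- now apply Rqpoch_inf_le.
- auto.
Qed.

(** * Euler's series for the reciprocal infinite product *)

Definition Euler_sum (q x : R) (n : nat) : R :=
  sum_n (fun k => x ^ k / Rqpoch q q k) n.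

Lemma Euler_sum_0 (q x : R) : Euler_sum q x 0 = 1.
Proof. unfold Euler_sum; rewrite sum_O; simpl; field. Qed.

Lemma Euler_sum_S (q x : R) (n : nat) :
  Euler_sum q x (S n) = Euler_sum q x n + x ^ S n / Rqpoch q q (S n).
Proof. exact (sum_Sn (fun k => x ^ k / Rqpoch q q k) n). Qed.

(** Since [1 - q^k] is the last factor of [(q;q)_k], the difference of the
    terms of index [k] is the term of index [k-1] times [x]. *)
Lemma Euler_sum_shift (q x : R) (n : nat) :
  0 < q < 1 ->
  Euler_sum q x (S n) - Euler_sum q (q * x) (S n) = x * Euler_sum q x n.
Proof.
intros Hq; induction n as [|n IH].
- rewrite !Euler_sum_S, !Euler_sum_0; simpl; field; lra.
- rewrite (Euler_sum_S q x (S n)), (Euler_sum_S q (q * x) (S n)).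
  rewrite (Euler_sum_S q x n) at 2.
  assert (Hpos : Rqpoch q q (S n) <> 0) by (apply Rgt_not_eq, Rqpoch_pos; lra).
  assert (H1 : 1 - q * q ^ S n <> 0).
  { pose proof (pow_unit_interval q (S n) Hq); nra. }
  rewrite Rmult_plus_distr_l, <- IH, Rpow_mult_distr.
  change (Rqpoch q q (S (S n))) with (Rqpoch q q (S n) * (1 - q * q ^ S n)).
  change (q ^ S (S n)) with (q * q ^ S n).
  change (x ^ S (S n)) with (x * x ^ S n).
  field; auto.
Qed.

Lemma Euler_sum_incr (q x : R) (n : nat) :
  0 < q < 1 -> 0 <= x -> Euler_sum q x n <= Euler_sum q x (S n).
Proof.
intros Hq Hx; rewrite Euler_sum_S.
assert (0 <= x ^ S n / Rqpoch q q (S n)); [|lra].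
apply Rdiv_le_0_compat; [now apply pow_le|apply Rqpoch_pos; lra].
Qed.

(** One more factor [1 - y], with [y = x q^m], turns [S_n(y)] into at most
    [S_n(y) - y S_(n-1)(y) = S_n(q y)]. *)
Lemma Euler_sum_mul_qpoch (q x : R) (n m : nat) :
  0 < q < 1 -> 0 <= x < 1 ->
  Euler_sum q x n * Rqpoch x q m <= Euler_sum q (x * q ^ m) n.
Proof.
intros Hq Hx; induction m as [|m IH]; simpl.
- rewrite !Rmult_1_r; lra.
- pose proof (pow_unit_interval q m Hq).
  assert (H0 : 0 <= x * q ^ m) by nra.
  replace (x * (q * q ^ m)) with (q * (x * q ^ m)) by ring.
  apply Rle_trans with (Euler_sum q (x * q ^ m) n * (1 - x * q ^ m)).
  { rewrite <- Rmult_assoc; apply Rmult_le_compat_r; [nra|exact IH]. }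
  destruct n as [|n].
  + rewrite !Euler_sum_0; lra.
  + pose proof (Euler_sum_shift q (x * q ^ m) n Hq).
    pose proof (Euler_sum_incr q (x * q ^ m) n Hq H0). nra.
Qed.

Lemma is_lim_Euler_sum_0 (q x : R) (n : nat) :
  0 < q < 1 -> is_lim_seq (fun m => Euler_sum q (x * q ^ m) n) 1.
Proof.
intros Hq.
assert (Hg : is_lim_seq (fun m => x * q ^ m) 0).
{ replace (Finite 0) with (Rbar_mult x 0) by (simpl; f_equal; ring).
  apply is_lim_seq_scal_l, is_lim_seq_geom.
  rewrite Rabs_pos_eq; lra. }
induction n as [|n IH].
- apply is_lim_seq_ext with (fun _ => 1); [|apply is_lim_seq_const].
  intros m; now rewrite Euler_sum_0.
- apply is_lim_seq_ext with (fun m => Euler_sum q (x * q ^ m) n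
     + (x * q ^ m) * ((x * q ^ m) ^ n / Rqpoch q q (S n))).
  { intros m; rewrite Euler_sum_S; simpl; unfold Rdiv; ring. }
  replace 1 with (1 + 0 * (0 ^ n / Rqpoch q q (S n))) by ring.
  apply is_lim_seq_plus'; [exact IH|].
  apply is_lim_seq_mult'; [exact Hg|].
  apply is_lim_seq_div'; [|apply is_lim_seq_const|].
  + clear IH; induction n as [|n IH]; simpl; [apply is_lim_seq_const|].
    now apply is_lim_seq_mult'.
  + apply Rgt_not_eq, Rqpoch_pos; lra.
Qed.

(** Let [m -> oo] in [S_n(x) (x;q)_m <= S_n(x q^m)]: the bound is uniform in
    [n] because every [S_n] takes the value 1 at 0. *)
Lemma Euler_sum_le (q x : R) (n : nat) :
  0 < q < 1 -> 0 <= x < 1 -> Euler_sum q x n <= / Rqpoch_inf x q.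
Proof.
intros Hq Hx.
pose proof (Rqpoch_inf_pos x q Hq Hx) as Hpos.
apply Rmult_le_reg_r with (Rqpoch_inf x q); [exact Hpos|].
rewrite Rinv_l by lra.
apply (is_lim_seq_le (fun m => Euler_sum q x n * Rqpoch x q m)
  (fun m => Euler_sum q (x * q ^ m) n) (Finite _) (Finite _)).
- intros m; now apply Euler_sum_mul_qpoch.
- apply (is_lim_seq_scal_l _ _ (Finite _)). now apply is_lim_Rqpoch.
- now apply is_lim_Euler_sum_0.
Qed.

(** * Dominated complex series *)

(** The majorant is nonnegative, so a bound on its partial sums makes it
    converge; completeness of the complex numbers then gives the sum of [u],
    and the bound passes to the limit by continuity of the modulus. *)
Lemma CSeries_dominated (u : nat -> C) (v : nat -> R) (B : R) :
  (forall k, Cmod (u k) <= v k) -> (forall n, sum_n v n <= B) ->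
  is_Cseries u (CSeries u) /\ Cmod (CSeries u) <= B.
Proof.
intros Huv HB.
assert (Hv : ex_series v).
{ apply ex_finite_lim_seq_incr with (M := B); [|exact HB].
  intros n; rewrite sum_Sn; change (plus ?a ?b) with (a + b).
  pose proof (Cmod_ge_0 (u (S n))); pose proof (Huv (S n)); lra. }
destruct (ex_series_le (V := C_CompleteNormedModule) u v Huv Hv) as [w Hw].
assert (Hu : is_Cseries u w) by exact Hw.
rewrite (is_Cseries_unique u w Hu); split; [exact Hu|].
apply (is_lim_seq_le (fun n => Cmod (sum_n u n)) (fun _ => B)
  (Finite _) (Finite _)); [|exact (filterlim_comp _ _ _ _ _ _ _ _ Hw
    (filterlim_norm (V := C_NormedModule) w))|apply is_lim_seq_const].
intros n; eapply Rle_trans; [|apply (HB n)].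
eapply Rle_trans; [apply (norm_sum_n_m (V := C_NormedModule) u 0 n)|].
apply sum_n_m_le; exact Huv.
Qed.

(** * The bound for the series f *)

(** The factor [(q^l)^k] is kept outside of the maximum over [k], because it
    is the power that Euler's series at [q^l] sums. *)
Lemma gauss_term_le (q l Z : R) (k : nat) :
  0 < q < 1 -> 0 < l -> 0 < Z ->
  Rpower q (l * INR k ^ 2) * Z ^ k
  <= Rpower (Z ^ 2 * Rpower q (- l)) (1 / 4)
     * exp (- ((ln Z) ^ 2 / (4 * l * ln q))) * Rpower q l ^ k.
Proof.
intros Hq Hl HZ.
assert (HL : ln q < 0) by (rewrite <- ln_1; apply ln_increasing; lra).
rewrite <- (Rpower_pow k Z HZ), <- (Rpower_pow k (Rpower q l)) by apply exp_pos.
unfold Rpower.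
rewrite ln_mult by (apply exp_pos || now apply pow_lt).
rewrite (ln_pow Z 2 HZ), !ln_exp, <- !exp_plus.
(* The difference of the two exponents is a square divided by [-4 l log q]. *)
set (t := ln Z); set (L := ln q) in *; set (x := INR k).
assert (HlL : 0 < - l * L) by nra.
assert (Hsq : 1 / 4 * (INR 2 * t + - l * L) + - (t ^ 2 / (4 * l * L))
   + x * (l * L) - (l * x ^ 2 * L + x * t)
   = (t + - l * L - 2 * (- l * L) * x) ^ 2 / (4 * (- l * L))).
{ simpl (INR 2); field; split; lra. }
assert (0 <= (t + - l * L - 2 * (- l * L) * x) ^ 2 / (4 * (- l * L))).
{ apply Rdiv_le_0_compat; [apply pow2_ge_0|lra]. }
match goal with |- exp ?a <= exp ?b => assert (Hle : a <= b) by lra end.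
destruct Hle as [Hlt|Heq]; [apply Rlt_le, exp_increasing, Hlt|rewrite Heq; lra].
Qed.

(** The modulus enters through an upper bound [Z > 0], so that the point
    [z = 0], where [log |z|] makes no sense, is covered as well. *)
Lemma f_term_le (a : list C) (b : list R) (q l Z : R) (z : C) (k : nat) :
  0 < q < 1 -> (forall x, In x b -> 0 <= x < 1) -> 0 < l ->
  0 < Z -> Cmod z <= Z ->
  Cmod (f_term a b q l z k)
  <= Rqpochs_inf (map (fun x => - Cmod x) a) q / Rqpochs_inf b q
     * (Rpower (Z ^ 2 * Rpower q (- l)) (1 / 4)
        * exp (- ((ln Z) ^ 2 / (4 * l * ln q))))
     * (Rpower q l ^ k / Rqpoch q q k).
Proof.
intros Hq Hb Hl HZ Hz.
pose proof (Rqpochs_inf_pos b q Hq Hb) as HB.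
pose proof (Rqpochs_inf_le_Cmod b q k Hq Hb) as HBk.
assert (Hqk : 0 < Rqpoch q q k) by (apply Rqpoch_pos; lra).
unfold f_term.
rewrite Cqpochs_app.
replace (Cqpochs [RtoC q] q k) with (RtoC (Rqpoch q q k))
  by (unfold Cqpochs; simpl; rewrite Cqpoch_RtoC; ring).
assert (Hden : Cqpochs (map RtoC b) q k <> 0%C) by (apply Cmod_gt_0; lra).
rewrite Cmod_mult, Cmod_div, !Cmod_mult, !Cmod_R, Cmod_pow.
2:{ apply Cmult_neq_0; [exact Hden|].
    intros H; apply (f_equal Re) in H; simpl in H; lra. }
rewrite (Rabs_pos_eq (Rqpoch q q k)), (Rabs_pos_eq (Rpower _ _))
  by (apply Rlt_le; assumption || apply exp_pos).
set (M := Rpower (Z ^ 2 * Rpower q (- l)) (1 / 4) * _).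
assert (HG : Rpower q (l * INR k ^ 2) * Cmod z ^ k <= M * Rpower q l ^ k).
{ eapply Rle_trans; [|now apply gauss_term_le].
  apply Rmult_le_compat_l; [apply Rlt_le, exp_pos|].
  apply pow_incr; split; [apply Cmod_ge_0|exact Hz]. }
assert (HA : Cmod (Cqpochs a q k) / Cmod (Cqpochs (map RtoC b) q k)
  <= Rqpochs_inf (map (fun x => - Cmod x) a) q / Rqpochs_inf b q).
{ apply Rmult_le_compat.
  - apply Cmod_ge_0.
  - apply Rlt_le, Rinv_0_lt_compat; lra.
  - now apply Cmod_Cqpochs_le.
  - now apply Rinv_le_contravar. }
replace (Cmod (Cqpochs a q k) * Rpower q (l * INR k ^ 2)
    / (Cmod (Cqpochs (map RtoC b) q k) * Rqpoch q q k) * Cmod z ^ k)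
  with (Cmod (Cqpochs a q k) / Cmod (Cqpochs (map RtoC b) q k)
    * ((Rpower q (l * INR k ^ 2) * Cmod z ^ k) / Rqpoch q q k))
  by (field; lra).
rewrite Rmult_assoc; apply Rmult_le_compat.
- apply Rdiv_le_0_compat; [apply Cmod_ge_0|lra].
- apply Rdiv_le_0_compat; [|exact Hqk].
  apply Rmult_le_pos; [apply Rlt_le, exp_pos|apply pow_le, Cmod_ge_0].
- exact HA.
- unfold Rdiv; rewrite <- Rmult_assoc.
  apply Rmult_le_compat_r; [now apply Rlt_le, Rinv_0_lt_compat|exact HG].
Qed.

Lemma f_series_bound (a : list C) (b : list R) (q l Z : R) (z : C) :
  0 < q < 1 -> (forall x, In x b -> 0 <= x < 1) -> 0 < l ->
  0 < Z -> Cmod z <= Z ->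
  is_Cseries (f_term a b q l z) (f_series a b q l z) /\
  Cmod (f_series a b q l z)
  <= Rqpochs_inf (map (fun x => - Cmod x) a) q
     / Rqpochs_inf (b ++ [Rpower q l]) q
     * (Rpower (Z ^ 2 * Rpower q (- l)) (1 / 4)
        * exp (- ((ln Z) ^ 2 / (4 * l * ln q)))).
Proof.
intros Hq Hb Hl HZ Hz.
assert (Hx : 0 <= Rpower q l < 1).
{ split; [apply Rlt_le, exp_pos|].
  assert (HL : ln q < 0) by (rewrite <- ln_1; apply ln_increasing; lra).
  unfold Rpower; rewrite <- exp_0; apply exp_increasing; nra. }
pose proof (Rqpochs_inf_pos b q Hq Hb) as HB.
pose proof (Rqpoch_inf_pos _ q Hq Hx) as HI.
set (K := Rqpochs_inf (map (fun x => - Cmod x) a) q / Rqpochs_inf b q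
  * (Rpower (Z ^ 2 * Rpower q (- l)) (1 / 4)
     * exp (- ((ln Z) ^ 2 / (4 * l * ln q))))).
apply CSeries_dominated
  with (v := fun k => K * (Rpower q l ^ k / Rqpoch q q k)).
{ intros k; apply f_term_le; assumption. }
intros n.
rewrite (sum_n_mult_l (K := R_Ring) K).
change (sum_n _ n) with (Euler_sum q (Rpower q l) n).
change (mult K ?e) with (K * e).
assert (HK : 0 <= K).
{ apply Rmult_le_pos.
  - apply Rdiv_le_0_compat; [|exact HB].
    eapply Rle_trans; [apply Cmod_ge_0|apply (Cmod_Cqpochs_le a q 0 Hq)].
  - apply Rmult_le_pos; apply Rlt_le, exp_pos. }
eapply Rle_trans;
  [apply Rmult_le_compat_l; [exact HK|now apply Euler_sum_le]|].
rewrite Rqpochs_inf_app; unfold K, Rqpochs_inf at 5; simpl.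
apply Req_le; field; lra.
Qed.

(** * The confluent basic hypergeometric series *)

(** Writing [-q^((k-1)/2) = (-q^(-1/2)) q^(k/2)], the [k m]-th power of the
    first factor is the [k]-th power of [(-q^(-1/2))^m] and joins [z^k], while
    that of the second is the Gaussian weight [q^((m/2) k^2)]. *)
Lemma rphis_term_f_term (a : list C) (b : list R) (q : R) (z : C) (k : nat) :
  0 < q ->
  let m := (length b + 1 - length a)%nat in
  rphis_term a (map RtoC b) q z k
  = f_term a b q (INR m / 2) (z * RtoC ((- Rpower q (- (1 / 2))) ^ m)) k.
Proof.
intros Hq m; unfold rphis_term, f_term.
rewrite length_map; fold m.
rewrite Cpow_mult_l, <- RtoC_pow, <- pow_mult.
replace (Cqpochs (map RtoC b ++ [RtoC q]) q k)
  with (Cqpochs (RtoC q :: map RtoC b) q k)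
  by (rewrite Cqpochs_app; unfold Cqpochs; simpl; ring).
replace ((- Rpower q ((INR k - 1) / 2)) ^ (k * m))
  with (Rpower q (INR m / 2 * INR k ^ 2) * (- Rpower q (- (1 / 2))) ^ (m * k)).
- rewrite RtoC_mult; unfold Cdiv; ring.
- replace ((INR k - 1) / 2) with (- (1 / 2) + INR k / 2) by field.
  rewrite Rpower_plus, Ropp_mult_distr_l, Rpow_mult_distr.
  rewrite <- (Rpower_pow (k * m) (Rpower q (INR k / 2))) by apply exp_pos.
  rewrite Rpower_mult, mult_INR, (Nat.mul_comm m k), Rmult_comm.
  f_equal; f_equal; field.
Qed.

Lemma CSeries_ext (u v : nat -> C) :
  (forall k, u k = v k) -> CSeries u = CSeries v.
Proof.
intros H; unfold CSeries; f_equal; apply Series_ext; intros k; now rewrite H.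
Qed.

Theorem theorem2p1 (q : R) (r s : nat) (a : list C) (b : list R)
  (Hq : 0 < q < 1)
  (Ha : length a = r) (Hb : length b = s)
  (Hb01 : forall x : R, In x b -> 0 <= x < 1) :
  (forall l : R, 0 < l ->
     (forall z : C, is_Cseries (f_term a b q l z) (f_series a b q l z)) /\
     (forall z : C, z <> RtoC 0 ->
        Cmod (f_series a b q l z)
        <= Rqpochs_inf (map (fun x => - Cmod x) a) q
           / Rqpochs_inf (b ++ [Rpower q l]) q
           * (Rpower (Cmod z ^ 2 * Rpower q (- l)) (1 / 4)
              * exp (- ((ln (Cmod z)) ^ 2 / (4 * l * ln q))))))
  /\
  ((0 < s + 1 - r)%nat ->
     (forall z : C, is_Cseries (rphis_term a (map RtoC b) q z)
                               (rphis a (map RtoC b) q z)) /\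
     (forall z : C, z <> RtoC 0 ->
        Cmod (rphis a (map RtoC b) q z)
        <= Rqpochs_inf (map (fun x => - Cmod x) a) q
           / Rqpochs_inf (b ++ [Rpower q ((INR s + 1 - INR r) / 2)]) q
           * (Rpower (Cmod z ^ 2
                      * Rpower q (3 * (INR r - INR s - 1) / 2)) (1 / 4)
              * exp ((ln (Cmod z * Rpower q ((INR r - INR s - 1) / 2))) ^ 2
                     / (2 * (INR r - INR s - 1) * ln q))))).
Proof.
assert (Hpart1 : forall l : R, 0 < l ->
     (forall z : C, is_Cseries (f_term a b q l z) (f_series a b q l z)) /\
     (forall z : C, z <> RtoC 0 ->
        Cmod (f_series a b q l z)
        <= Rqpochs_inf (map (fun x => - Cmod x) a) q
           / Rqpochs_inf (b ++ [Rpower q l]) q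
           * (Rpower (Cmod z ^ 2 * Rpower q (- l)) (1 / 4)
              * exp (- ((ln (Cmod z)) ^ 2 / (4 * l * ln q)))))).
{ intros l Hl; split; intros z.
  (* Convergence is claimed at [z = 0] too, hence a strictly positive bound
     on the modulus. *)
  - pose proof (Cmod_ge_0 z).
    apply (f_series_bound a b q l (Cmod z + 1) z); auto; lra.
  - intros Hz.
    apply (f_series_bound a b q l (Cmod z) z); auto; [|lra].
    now apply Cmod_gt_0. }
split; [exact Hpart1|].
intros Hrs.
set (m := (length b + 1 - length a)%nat).
assert (Hm : INR m = INR s + 1 - INR r).
{ unfold m; rewrite Ha, Hb, minus_INR, plus_INR by lia; reflexivity. }
assert (Hm0 : 0 < INR m) by (apply lt_0_INR; unfold m; lia).
set (c := RtoC ((- Rpower q (- (1 / 2))) ^ m)).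
assert (Hterm : forall z k, rphis_term a (map RtoC b) q z k
    = f_term a b q (INR m / 2) (z * c) k)
  by (intros z k; apply rphis_term_f_term; lra).
assert (Hsum : forall z, rphis a (map RtoC b) q z
    = f_series a b q (INR m / 2) (z * c))
  by (intros z; apply CSeries_ext, Hterm).
assert (Hc : Cmod c = Rpower q (- (INR m / 2))).
{ unfold c; rewrite Cmod_R, <- RPow_abs, Rabs_Ropp, Rabs_pos_eq
    by apply Rlt_le, exp_pos.
  rewrite <- Rpower_pow, Rpower_mult by apply exp_pos.
  f_equal; field. }
destruct (Hpart1 (INR m / 2)) as [Hconv Hbound]; [lra|].
split; intros z.
- rewrite Hsum.
  apply is_series_ext with (2 := Hconv (z * c)%C).
  intros k; symmetry; apply Hterm.
- intros Hz.
  assert (Hzpos : 0 < Cmod z) by now apply Cmod_gt_0.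
  assert (Hzc : (z * c)%C <> RtoC 0).
  { apply Cmod_gt_0; rewrite Cmod_mult, Hc.
    apply Rmult_lt_0_compat; [exact Hzpos|apply exp_pos]. }
  specialize (Hbound _ Hzc).
  rewrite Hsum.
  assert (HL : ln q < 0) by (rewrite <- ln_1; apply ln_increasing; lra).
  (* The bound of [f] at [z * c], where [|z c| = |z| q^(-m/2)], is the claimed
     one once the powers of [q] are collected. *)
  rewrite Cmod_mult, Hc in Hbound.
  replace ((INR s + 1 - INR r) / 2) with (INR m / 2) by lra.
  replace ((INR r - INR s - 1) / 2) with (- (INR m / 2)) by lra.
  replace (2 * (INR r - INR s - 1) * ln q) with (- (4 * (INR m / 2) * ln q))
    by (rewrite Hm; field).
  rewrite Rdiv_opp_r.
  replace (Cmod z ^ 2 * Rpower q (3 * (INR r - INR s - 1) / 2))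
    with ((Cmod z * Rpower q (- (INR m / 2))) ^ 2 * Rpower q (- (INR m / 2)));
    [exact Hbound|].
  rewrite Rpow_mult_distr, Rmult_assoc; f_equal.
  simpl (Rpower _ _ ^ 2); rewrite Rmult_1_r, <- !Rpower_plus.
  f_equal; rewrite Hm; field.
Qed.
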